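(* Let $\{X_k \mid k\in\mathbb{Z}\}$ be a zero-mean wide-sense stationary (real-valued) process with variance $c_0$. For $n\in\mathbb{N}$ let $\mathbf{C}_n$ be the $n\times n$ covariance matrix of $n$ consecutive samples and let $M_n \triangleq \frac1n\operatorname{trace}\{\mathbf{C}_n^{-1}\}$. Then the sequence $\{M_n\mid n\in\mathbb{N}\}$ is monotonically non-decreasing: for all $n\in\mathbb{N}$, $$M_n\le M_{n+1}.$$ Moreover, equality $M_n=M_{n+1}$ holds if and only if either $\mathbf{C}_{n+1}=c_0\cdot \mathbf{I}_{n+1}$, in which case $M_1=M_2=\cdots=M_{n+1}=1/c_0$; or $\mathbf{C}_n$ is singular, in which case $M_n=M_{n+1}=\infty$. (In particular, equality for all $n\in\mathbb{N}$ holds if and only if $\{X_k\}$ is white.)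
   Context: $\mathbb{N}=\{1,2,\dots\}$; $\mathbf{I}_n$ is the $n\times n$ identity matrix. For a zero-mean wide-sense stationary process, $c_\ell\triangleq\mathbb{E}\{X_{i+\ell}X_i\}$ (independent of $i$), and $\mathbf{C}_n=\mathbb{E}\{(X_1,\dots,X_n)^T(X_1,\dots,X_n)\}$ is the symmetric Toeplitz matrix with $(i,j)$ entry $c_{|i-j|}$. The process is white if $c_\ell=0$ for all $\ell\ne0$. Conventions: $1/0\triangleq\infty$, and $\operatorname{trace}\{\mathbf{A}^{-1}\}\triangleq\infty$ for a singular positive semidefinite matrix $\mathbf{A}$. *)

(* Defs.v *)
From HB Require Import structures.
From mathcomp Require Import all_boot all_order all_algebra.
From mathcomp Require Import all_classical all_reals all_analysis.

Set Implicit Arguments.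
Unset Strict Implicit.
Unset Printing Implicit Defensive.

Import Order.TTheory GRing.Theory Num.Theory.
Import numFieldNormedType.Exports.

Local Open Scope ring_scope.

Section process.
Context (d : measure_display) (T : measurableType d) (R : realType).
Context (P : probability T R).

(* The second moments are compared in the extended reals; they are finite
   because every sample is square-integrable. *)
Record wide_sense_stationary (X : int -> {RV P >-> R}) : Prop := {
  wss_square_integrable : forall i : int, (X i : T -> R) \in Lfun P 2%:E;
  wss_mean : forall i j : int, ('E_P[X i] = 'E_P[X j])%E;
  wss_correlation : forall i j l : int,
    ('E_P[X (i + l)%R \* X i] = 'E_P[X (j + l)%R \* X j])%E }.

Definition zero_mean (X : int -> {RV P >-> R}) : Prop :=
  forall i : int, ('E_P[X i] = 0)%E.

(* E[X_(i+l) X_i] taken at i = 0; under wide-sense stationarity the choice of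
   i is immaterial, see autocov_shift. *)
Definition autocov (X : int -> {RV P >-> R}) (l : int) : R :=
  fine ('E_P[X l \* X 0%R])%E.

Definition white (X : int -> {RV P >-> R}) : Prop :=
  forall l : int, l != 0 -> autocov X l = 0.

(* The row and column i : 'I_n, which is counted from 0, belongs to the sample
   X_(i+1). *)
Definition cov_mx (X : int -> {RV P >-> R}) (n : nat) : 'M[R]_n :=
  \matrix_(i < n, j < n) fine ('E_P[X i.+1%:Z \* X j.+1%:Z])%E.

End process.

(* Only meant for positive semidefinite A, where the trace of the inverse of a
   singular matrix is +oo by convention. *)
Definition trace_inv (R : realType) (n : nat) (A : 'M[R]_n) : \bar R :=
  if A \in unitmx then (\tr (invmx A))%:E else +oo%E.

Definition mean_trace_inv (d : measure_display) (T : measurableType d)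
    (R : realType) (P : probability T R) (X : int -> {RV P >-> R}) (n : nat) :
    \bar R :=
  ((n%:R^-1)%:E * trace_inv (cov_mx X n))%E.

Section facts.
Context (d : measure_display) (T : measurableType d) (R : realType).
Context (P : probability T R) (X : int -> {RV P >-> R}).
Context (X_wss : wide_sense_stationary X).

Lemma autocov_shift (i l : int) :
  autocov X l = fine ('E_P[X (i + l)%R \* X i])%E.
Proof. by rewrite (wss_correlation X_wss i 0 l) add0r. Qed.

Lemma autocovN (l : int) : autocov X (- l) = autocov X l.
Proof.
rewrite (autocov_shift l) subrr /autocov; congr (fine (expectation P _)).
by apply/funext => w /=; rewrite mulrC.
Qed.

Lemma cov_mx_toeplitz (n : nat) (i j : 'I_n) :
  cov_mx X n i j = autocov X `|i%:Z - j%:Z|.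
Proof.
transitivity (autocov X (i%:Z - j%:Z)).
  rewrite mxE (autocov_shift j.+1%:Z); congr (fine (expectation P (X _ \* _))).
  by rewrite !intS -addrA [j%:Z + _]addrC subrK.
by case: (ger0P (i%:Z - j%:Z)) => _ //; rewrite -autocovN.
Qed.

End facts.

(* Main.v *)
Require Import Defs.
From HB Require Import structures.
From mathcomp Require Import all_boot all_order all_algebra.
From mathcomp Require Import all_classical all_reals all_analysis.
From mathcomp Require Import ring zify.

Set Implicit Arguments.
Unset Strict Implicit.
Unset Printing Implicit Defensive.

Import Order.TTheory GRing.Theory Num.Theory.
Import numFieldNormedType.Exports.

Local Open Scope ring_scope.

(* Let B be the inverse of C_{n+1} and D the inverse of C_n. As C_{n+1} is
   Toeplitz, C_n is what remains of it after deleting the last index, and also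
   after deleting the first one; inverting a principal submatrix does not
   increase the diagonal, so D_ii <= B_ii and D_ii <= B_{i+1,i+1}. Adding these
   inequalities with weights n - i and i + 1 (0 <= i < n) gives
   (n+1) tr D <= n tr B. In case of equality D_ii = B_ii for all i, which forces
   the last column of C_{n+1} to vanish off the diagonal. *)

(** * Positive semidefinite matrices and their principal submatrices *)

Definition psdmx (R : numDomainType) n (A : 'M[R]_n) : Prop :=
  A^T = A /\ forall u : 'rV_n, 0 <= (u *m A *m u^T) 0 0.

Section psd_matrices.
Context (R : realFieldType).

Lemma rowV_sqr_eq0 n (v : 'rV[R]_n) : (v *m v^T) 0 0 = 0 -> v = 0.
Proof.
rewrite mxE => v0; apply/rowP => i; rewrite mxE.
have /psumr_eq0P : forall j : 'I_n, true -> 0 <= v 0 j * v^T j 0.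
  by move=> j _; rewrite mxE -expr2 sqr_ge0.
move=> /(_ v0 i isT); rewrite mxE => /eqP.
by rewrite -expr2 sqrf_eq0 => /eqP.
Qed.

(** With [v = u A], the form at [t u + v] is affine in [t] with slope twice the squared norm of [v],
    so it stays nonnegative only if [v = 0]. *)
Lemma psdmx_ker n (A : 'M[R]_n) (u : 'rV_n) :
  psdmx A -> (u *m A *m u^T) 0 0 = 0 -> u *m A = 0.
Proof.
move=> [Asym A_ge0] u0; apply: rowV_sqr_eq0; apply/eqP/negP => /negP.
set v := u *m A; set s := (v *m v^T) 0 0 => s0.
have AuT : A *m u^T = v^T by rewrite trmx_mul Asym.
pose q := (v *m A *m v^T) 0 0.
have quad t : ((t *: u + v) *m A *m (t *: u + v)^T) 0 0 = t * s *+ 2 + q.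
  have vAu : v *m A *m u^T = v *m v^T by rewrite -mulmxA AuT.
  have uAv : u *m A *m v^T = v *m v^T by [].
  have -> : (t *: u + v)^T = t *: u^T + v^T by rewrite linearD linearZ.
  rewrite !mulmxDl !mulmxDr -!scalemxAl -!scalemxAr vAu uAv.
  by move: u0; rewrite /s /q !mxE => ->; rewrite !mulr0 add0r mulr2n addrA.
(* This value of [t] makes the form equal to -1. *)
have := A_ge0 (- (q + 1) / (s *+ 2) *: u + v).
rewrite quad -mulrnAr mulfVK ?mulrn_eq0 // opprD addrAC addNr add0r.
by rewrite oppr_ge0 ler10.
Qed.

(** [rowsub f 1%:M] is the 0-1 selection matrix, which turns taking a submatrix into a
    congruence. *)
Lemma mxsubEmul m n (f : 'I_m -> 'I_n) (C : 'M[R]_n) :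
  mxsub f f C = rowsub f 1%:M *m C *m (rowsub f 1%:M)^T.
Proof.
by rewrite mul_rowsub_mx mul1mx trmx_mxsub trmx1 mulmx_colsub mulmx1 mxsubcr.
Qed.

Lemma rowsub1_trmx m n (f : 'I_m -> 'I_n) :
  injective f -> rowsub f 1%:M *m (rowsub f 1%:M)^T = 1%:M :> 'M[R]_m.
Proof.
move=> f_inj; have := mxsubEmul f 1%:M; rewrite mulmx1 => <-.
by apply/matrixP => i j; rewrite !mxE (inj_eq f_inj).
Qed.

Lemma psdmx_mxsub m n (f : 'I_m -> 'I_n) (C : 'M[R]_n) :
  psdmx C -> psdmx (mxsub f f C).
Proof.
move=> [Csym C_ge0]; split; first by rewrite trmx_mxsub Csym.
move=> u; rewrite mxsubEmul.
by have := C_ge0 (u *m rowsub f 1%:M); rewrite trmx_mul !mulmxA.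
Qed.

(** A kernel vector of the submatrix, padded with zeros, is isotropic for [C] and hence in its
    kernel by [psdmx_ker]. *)
Lemma psdmx_mxsub_unit m n (f : 'I_m -> 'I_n) (C : 'M[R]_n) :
  injective f -> psdmx C -> C \in unitmx -> mxsub f f C \in unitmx.
Proof.
move=> f_inj Cpsd Cunit; rewrite unitmxE unitfE; apply/det0P => -[u u0 uA].
pose E : 'M[R]_(m, n) := rowsub f 1%:M.
have uEC : u *m E *m C = 0.
  apply: psdmx_ker => //; have := uA; rewrite mxsubEmul -/E => uA'.
  by rewrite trmx_mul mulmxA -(mulmxA u) -(mulmxA u) uA' mul0mx mxE.
have uE : u *m E = 0 by rewrite -(mulmxK Cunit (u *m E)) uEC mul0mx.
by case/eqP: u0; rewrite -(mulmx1 u) -(rowsub1_trmx f_inj) mulmxA uE mul0mx.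
Qed.

(** * Inverting a submatrix versus restricting the inverse *)

Section compression.
Context (m n : nat) (f : 'I_m -> 'I_n) (C : 'M[R]_n).
Hypotheses (Cpsd : psdmx C) (Cunit : C \in unitmx).
Hypothesis f_inj : injective f.

Local Notation A := (mxsub f f C).
Local Notation E := (rowsub f 1%:M : 'M[R]_(m, n)).

Let W := E *m invmx C - invmx A *m E.

(** Expand with [E E^T = 1] and [E C E^T = A]: the last three of the four products sum to
    [- invmx A]. The right-hand side is a congruence of [C], hence positive semidefinite. *)
Let compressionE :
  mxsub f f (invmx C) - invmx A = W *m C *m W^T.
Proof.
have [Csym _] := Cpsd; have [Asym _] := psdmx_mxsub f Cpsd.
have WC : W *m C = E - invmx A *m E *m C.
  by rewrite mulmxBl mulmxKV.
have WT : W^T = invmx C *m E^T - E^T *m invmx A.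
  by rewrite linearB /= !trmx_mul !trmx_inv Csym Asym.
rewrite WC WT mulmxBl !mulmxBr !mulmxA mulmxK // -!(mulmxA (invmx A)).
rewrite -!mxsubEmul rowsub1_trmx // mulmxV ?psdmx_mxsub_unit //.
by rewrite !mul1mx mulmx1 subrr subr0.
Qed.

Let compression_diag i :
  invmx C (f i) (f i) - invmx A i i = (row i W *m C *m (row i W)^T) 0 0.
Proof.
have /matrixP/(_ i i) := compressionE; rewrite !mxE => ->.
by apply: eq_bigr => j _; rewrite -row_mul !mxE.
Qed.

Lemma invmx_mxsub_diag_le i : invmx A i i <= invmx C (f i) (f i).
Proof. by rewrite -subr_ge0 compression_diag; apply: (proj2 Cpsd). Qed.

(** Equality makes every row of [W] isotropic for the invertible [C], so [W = 0], that is
    [E C = A E]; column [k] of [E] is zero when [f] misses [k]. *)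
Lemma invmx_mxsub_diag_eq :
  (forall i, invmx A i i = invmx C (f i) (f i)) ->
  forall i k, (forall l, f l != k) -> C (f i) k = 0.
Proof.
move=> diag_eq i k fNk.
have W0 : W = 0.
  apply/row_matrixP => l; rewrite row0 -(mulmxK Cunit (row l W)).
  rewrite (psdmx_ker Cpsd) ?mul0mx //.
  by rewrite -compression_diag diag_eq subrr.
have /eqP : E *m invmx C - invmx A *m E = 0 by [].
rewrite subr_eq0 => /eqP EC.
have /matrixP/(_ i k) : E *m C = A *m E.
  have Aunit : A \in unitmx by exact: psdmx_mxsub_unit.
  by rewrite -[E in RHS](mulmxKV Cunit) EC -mulmxA mulKVmx.
rewrite mul_rowsub_mx mul1mx mxE => ->.
by rewrite mxE big1 // => l _; rewrite !mxE (negPf (fNk l)) mulr0.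
Qed.

End compression.

(** * Trace comparison for a matrix whose two corner submatrices agree *)

Section bordered_trace.
Context (n : nat) (C : 'M[R]_n.+1) (A : 'M[R]_n).
Hypotheses (Cpsd : psdmx C) (Cunit : C \in unitmx).
Hypothesis A_last : A = mxsub (lift ord_max) (lift ord_max) C.
Hypothesis A_first : A = mxsub (lift ord0) (lift ord0) C.

(* Deleting the last index compares the i-th diagonal entry of invmx A with
   entry i of invmx C, deleting the first one with entry i.+1; the weights
   n - i and i.+1 then give every diagonal entry of invmx C total weight n. *)
Let gap : n%:R * \tr (invmx C) - n.+1%:R * \tr (invmx A) =
  \sum_(i < n)
    ((n - i)%:R * (invmx C (lift ord_max i) (lift ord_max i) - invmx A i i) +
     i.+1%:R * (invmx C (lift ord0 i) (lift ord0 i) - invmx A i i)).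
Proof.
pose b i := invmx C i i.
have -> : n%:R * \tr (invmx C) =
    \sum_(i < n.+1) (n - i)%:R * b i + \sum_(i < n.+1) i%:R * b i.
  rewrite mulr_sumr -big_split; apply: eq_bigr => i _ /=.
  by rewrite -mulrDl -natrD subnK // -ltnS.
(* The first sum has weight 0 at [i = n], the second at [i = 0]; without these terms both run over
   ['I_n]. *)
rewrite big_ord_recr /= subnn mul0r addr0 [X in _ + X - _]big_ord_recl mul0r add0r.
rewrite mulr_sumr -big_split -sumrB; apply: eq_bigr => i _ /=.
have -> : n.+1%:R = (n - i)%:R + i.+1%:R :> R.
  by rewrite -natrD addnS subnK // ltnW.
have -> : widen_ord (leqnSn n) i = lift ord_max i.
  by apply: ord_inj; rewrite lift_max.
by rewrite /b /bump leq0n add1n; ring.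
Qed.

Let gap_last (i : 'I_n) :
  0 <= (n - i)%:R * (invmx C (lift ord_max i) (lift ord_max i) - invmx A i i).
Proof.
rewrite mulr_ge0 // subr_ge0 A_last invmx_mxsub_diag_le //.
exact: lift_inj.
Qed.

Let gap_first (i : 'I_n) :
  0 <= i.+1%:R * (invmx C (lift ord0 i) (lift ord0 i) - invmx A i i).
Proof.
rewrite mulr_ge0 // subr_ge0 A_first invmx_mxsub_diag_le //.
exact: lift_inj.
Qed.

Lemma trace_invmx_border_le :
  n.+1%:R * \tr (invmx A) <= n%:R * \tr (invmx C).
Proof. by rewrite -subr_ge0 gap sumr_ge0 // => i _; rewrite addr_ge0. Qed.

(** All terms of [gap] vanish. As the weight [n - i] is positive for [i < n], equality holds in the
    comparison that deletes the last index, and [ord_max] is the index missed by [lift ord_max]. *)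
Lemma trace_invmx_border_eq :
  n.+1%:R * \tr (invmx A) = n%:R * \tr (invmx C) ->
  forall i, C (lift ord_max i) ord_max = 0.
Proof.
move=> tr_eq i; have := gap; rewrite -tr_eq subrr => /esym/psumr_eq0P gap0.
apply: invmx_mxsub_diag_eq => // [|j|j].
- exact: lift_inj.
- rewrite -A_last; apply/esym/eqP; rewrite -subr_eq0.
  have /eqP := gap0 (fun k _ => addr_ge0 (gap_last k) (gap_first k)) j isT.
  rewrite paddr_eq0 // mulf_eq0 pnatr_eq0.
  by case/andP; rewrite subn_eq0 leqNgt ltn_ord.
- by rewrite eq_sym neq_lift.
Qed.

End bordered_trace.

End psd_matrices.

(** * Covariance matrices of a stationary process *)

Section covariance_matrices.
Context (d : measure_display) (T : measurableType d) (R : realType).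
Context (P : probability T R) (X : int -> {RV P >-> R}).
Hypothesis X_wss : wide_sense_stationary X.

Local Notation c0 := (autocov X 0).
Local Notation M := (mean_trace_inv X).

(** The form at [u] is the second moment of the linear combination of samples with coefficients
    [u]. *)
Lemma psdmx_cov_mx n : psdmx (cov_mx X n).
Proof.
split=> [|u].
  apply/matrixP => i j; rewrite !mxE; congr (fine (expectation P _)).
  by apply/funext => w /=; rewrite mulrC.
pose h (p : 'I_n * 'I_n) w : \bar R :=
  (u 0 p.1 * u 0 p.2 * (X p.1.+1%:Z w * X p.2.+1%:Z w))%:E.
(* Products of square-integrable samples are integrable, which lets the finite double sum leave the
   integral. *)
have int_XX (i j : 'I_n) :
    P.-integrable setT (EFin \o (X i.+1%:Z \* X j.+1%:Z)).
  by apply/Lfun1_integrable/Lfun2_mul_Lfun1; apply: wss_square_integrable.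
have int_h p : P.-integrable setT (h p).
  by rewrite /h; under eq_fun do rewrite EFinM; exact/integrableZl/int_XX.
suff -> : (u *m cov_mx X n *m u^T) 0 0 =
    \int[P]_w ((\sum_i u 0 i * X i.+1%:Z w) ^+ 2).
  by apply: Rintegral_ge0 => w _; exact: sqr_ge0.
rewrite /Rintegral.
under eq_integral => w _.
  rewrite expr2 mulr_suml; under eq_bigr do rewrite mulr_sumr.
  rewrite pair_big /= -sumEFin.
  under eq_bigr do rewrite mulrACA.
  over.
rewrite (integral_sum _ int_h) //= -sum_fine; last first.
  by move=> p _; exact: integrable_fin_num.
rewrite -(pair_bigA _ (fun i j => fine (\int[P]_w h (i, j) w))) /=.
rewrite mxE exchange_big /=; apply: eq_bigr => j _.
rewrite !mxE mulr_suml; apply: eq_bigr => i _.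
rewrite !mxE /h; under [X in _ = fine X]eq_integral do rewrite EFinM.
rewrite integralZl //; last exact: int_XX.
rewrite fineM ?integrable_fin_num //; last exact: int_XX.
by rewrite unlock /= mulrAC.
Qed.

Lemma cov_mx_sub_last n :
  cov_mx X n = mxsub (lift ord_max) (lift ord_max) (cov_mx X n.+1).
Proof. by apply/matrixP => i j; rewrite !mxE !lift_max. Qed.

(** Shifting both indices by one keeps their difference, on which alone a Toeplitz entry depends. *)
Lemma cov_mx_sub_first n :
  cov_mx X n = mxsub (lift ord0) (lift ord0) (cov_mx X n.+1).
Proof.
apply/matrixP => i j; rewrite [RHS]mxE !(cov_mx_toeplitz X_wss) !lift0 !intS.
by rewrite opprD addrACA subrr add0r.
Qed.

Lemma cov_mx_unitS n : cov_mx X n.+1 \in unitmx -> cov_mx X n \in unitmx.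
Proof.
rewrite [cov_mx X n]cov_mx_sub_last; apply: psdmx_mxsub_unit.
- exact: lift_inj.
- exact: psdmx_cov_mx.
Qed.

(** The first column carries every lag from 0 to [n], and each other entry repeats one of these. *)
Lemma cov_mx_scalarP n :
  cov_mx X n.+1 = c0%:M <->
  forall l : nat, (0 < l <= n)%N -> autocov X l%:Z = 0.
Proof.
split=> [/matrixP CE l /andP[l0 ln]|c_eq0].
  have := CE (Ordinal (ln : (l < n.+1)%N)) ord0.
  by rewrite (cov_mx_toeplitz X_wss) mxE /= subr0 -val_eqE /= gtn_eqF.
apply/matrixP => i j; rewrite (cov_mx_toeplitz X_wss) mxE.
case: eqVneq => [->|ij]; first by rewrite subrr.
rewrite mulr0n -[`| _ |]/(`| i%:Z - j%:Z |%N%:Z) c_eq0 //.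
by have := ltn_ord i; have := ltn_ord j; move: ij; rewrite -val_eqE /=; lia.
Qed.

(** * Normalized traces of the inverses: finiteness, monotonicity, equality *)

Lemma mean_trace_inv_unit n : cov_mx X n \in unitmx ->
  M n = (n%:R^-1 * \tr (invmx (cov_mx X n)))%:E.
Proof. by move=> Cunit; rewrite /mean_trace_inv /trace_inv Cunit EFinM. Qed.

Lemma mean_trace_inv_singular n : (0 < n)%N -> cov_mx X n \notin unitmx ->
  M n = +oo%E.
Proof.
move=> n0 /negPf CNunit; rewrite /mean_trace_inv /trace_inv CNunit.
by rewrite gt0_muley // lte_fin invr_gt0 ltr0n.
Qed.

Lemma mean_trace_inv_eqy n : (0 < n)%N ->
  M n = +oo%E <-> cov_mx X n \notin unitmx.
Proof.
move=> n0; split; last exact: mean_trace_inv_singular.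
by move=> My; apply/negP => /mean_trace_inv_unit; rewrite My.
Qed.

(** The case [c0 = 0] is included: the matrix is then singular and both sides are [+oo] by
    convention. *)
Lemma mean_trace_inv_scalar n : (0 < n)%N -> cov_mx X n = c0%:M ->
  M n = (c0%:E^-1)%E.
Proof.
move=> n0 CE; rewrite inver.
have unitE : (cov_mx X n \in unitmx) = (c0 != 0).
  by rewrite CE unitmxE det_scalar unitfE expf_eq0 n0.
case: ifP => [c00|/negbT c00].
  by apply: mean_trace_inv_singular; rewrite // unitE c00.
rewrite mean_trace_inv_unit ?unitE // CE invmx_scalar mxtrace_scalar.
by rewrite -[X in _ * X]mulr_natl mulKf // pnatr_eq0 -lt0n.
Qed.

Lemma cov_mx_scalarW n k : (0 < k <= n.+1)%N ->
  cov_mx X n.+1 = c0%:M -> cov_mx X k = c0%:M.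
Proof.
case: k => // k /= kn /cov_mx_scalarP c_eq0; apply/cov_mx_scalarP => l.
by move=> /andP[l0 lk]; rewrite c_eq0 // l0 (leq_trans lk).
Qed.

Lemma mean_trace_inv_le n : (0 < n)%N -> (M n <= M n.+1)%E.
Proof.
move=> n0; have [CSunit|] := boolP (cov_mx X n.+1 \in unitmx); last first.
  by move=> /mean_trace_inv_singular -> //; rewrite leey.
rewrite !mean_trace_inv_unit //; last exact: cov_mx_unitS.
rewrite lee_fin.
rewrite ler_pdivrMl ?ltr0n // mulrCA ler_pdivlMl ?ltr0n //.
apply: trace_invmx_border_le => //; first exact: psdmx_cov_mx.
- exact: cov_mx_sub_last.
- exact: cov_mx_sub_first.
Qed.

Lemma mean_trace_inv_eq n : (0 < n)%N ->
  M n = M n.+1 <-> cov_mx X n.+1 = c0%:M \/ cov_mx X n \notin unitmx.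
Proof.
move=> n0; split=> [Meq|[CE|CNunit]]; last 2 first.
- rewrite !mean_trace_inv_scalar //.
  by apply: cov_mx_scalarW CE; rewrite n0 leqnSn.
- rewrite !mean_trace_inv_singular //.
  by apply: contra CNunit; exact: cov_mx_unitS.
have [Cunit|] := boolP (cov_mx X n \in unitmx); last by right.
(* [M n] is finite, hence so is the equal [M n.+1]. *)
have CSunit : cov_mx X n.+1 \in unitmx.
  apply: contraT => /(mean_trace_inv_eqy (ltn0Sn n)); rewrite -Meq.
  by move/(mean_trace_inv_eqy n0); rewrite Cunit.
left; apply/cov_mx_scalarP => l /andP[l0 ln].
move: Meq; rewrite !mean_trace_inv_unit // => -[Meq].
have /trace_invmx_border_eq C_last :
    n.+1%:R * \tr (invmx (cov_mx X n)) = n%:R * \tr (invmx (cov_mx X n.+1)).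
  have nN0 k : (0 < k)%N -> k%:R != 0 :> R by rewrite pnatr_eq0 -lt0n.
  rewrite -[X in n.+1%:R * X](mulVKf (nN0 n n0)) Meq mulrCA.
  by rewrite mulVKf ?nN0.
(* Lag [l] sits in the last column, of index [n], at row [n - l]; [0 < l] keeps it off the
   diagonal. *)
have nl : (n - l < n)%N by rewrite ltn_subrL l0.
have := C_last (psdmx_cov_mx _) CSunit (cov_mx_sub_last n)
  (cov_mx_sub_first n) (Ordinal nl).
rewrite (cov_mx_toeplitz X_wss) lift_max /= => <-; congr autocov.
lia.
Qed.

(** * White processes *)

Lemma autocov0_white : c0 = 0 -> white X.
Proof.
move=> c00; suff c_eq0 (l : nat) : autocov X l%:Z = 0.
  by move=> [l|l] _; rewrite ?c_eq0 // NegzE (autocovN X_wss) c_eq0.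
(* The first unit vector has form value [c0 = 0], so the first row vanishes; its last entry is lag
   [l]. *)
have /psdmx_ker := psdmx_cov_mx l.+1 => /(_ (delta_mx 0 ord0)).
rewrite -rowE trmx_delta -colE 2!mxE (cov_mx_toeplitz X_wss) subrr c00.
move=> /(_ erefl)/rowP/(_ ord_max).
by rewrite [LHS]mxE [RHS]mxE (cov_mx_toeplitz X_wss) sub0r normrN.
Qed.

Lemma mean_trace_inv_eq_white :
  (forall n, (0 < n)%N -> M n = M n.+1) <-> white X.
Proof.
split=> [Meq|Xwhite n n0].
  (* If [c0 = 0], every [M n] with [0 < n] is [+oo] and the equalities carry no information. *)
  have [/eqP/autocov0_white //|c00] := boolP (c0 == 0).
  have C1 : cov_mx X 1 = c0%:M by apply/cov_mx_scalarP; case.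
  (* [M] is constantly [M 1], finite as [c0 != 0]; so no matrix is singular and only the scalar
     alternative of [mean_trace_inv_eq] remains. *)
  have Mconst n : M n.+1 = M 1%N by elim: n => // n <-; rewrite -Meq.
  have Cunit n : cov_mx X n.+1 \in unitmx.
    apply: contraT => /(mean_trace_inv_singular (ltn0Sn n)).
    rewrite Mconst => /(mean_trace_inv_eqy (ltn0Sn 0)).
    by rewrite C1 unitmxE det_scalar unitfE expr1 c00.
  have c_eq0 (l : nat) : autocov X l.+1%:Z = 0.
    have l0 := ltn0Sn l.
    have [/cov_mx_scalarP-> //|] := (mean_trace_inv_eq l0).1 (Meq _ l0).
      by rewrite leqnn.
    by rewrite Cunit.
  by move=> [[|l]|l] // _; rewrite ?NegzE ?(autocovN X_wss) c_eq0.
apply/mean_trace_inv_eq => //; left; apply/cov_mx_scalarP => l /andP[l0 _].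
by rewrite Xwhite // eqz_nat -lt0n.
Qed.

End covariance_matrices.

Theorem theorem1 (d : measure_display) (T : measurableType d) (R : realType)
    (P : probability T R) (X : int -> {RV P >-> R})
    (X_wss : wide_sense_stationary X) (X_zero_mean : zero_mean X) :
  let c0 := autocov X 0 in
  let M := mean_trace_inv X in
  [/\ forall n : nat, (0 < n)%N -> (M n <= M n.+1)%E,
      forall n : nat, (0 < n)%N ->
        (M n = M n.+1 <->
         cov_mx X n.+1 = c0%:M \/ cov_mx X n \notin unitmx),
      forall n : nat, (0 < n)%N -> cov_mx X n.+1 = c0%:M ->
        forall k : nat, (0 < k <= n.+1)%N -> M k = (c0%:E^-1)%E,
      forall n : nat, (0 < n)%N -> cov_mx X n \notin unitmx ->
        M n = +oo%E /\ M n.+1 = +oo%E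
    & (forall n : nat, (0 < n)%N -> M n = M n.+1) <-> white X].
Proof.
split=> [n|n|n _ CE k kn|n n0 CNunit|].
- exact: mean_trace_inv_le.
- exact: mean_trace_inv_eq.
- apply: mean_trace_inv_scalar; first by case/andP: kn.
  exact: cov_mx_scalarW CE.
- by split; apply: mean_trace_inv_singular => //;
    apply: contra CNunit; exact: cov_mx_unitS.
- exact: mean_trace_inv_eq_white.
Qed.
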